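(* Let $k$ be a positive integer. If $T$ is a finite tree with $2k-3 \leq \operatorname{diam}(T) \leq 2k-2$, then $c_{H,k}(T) \leq 3$.
   Context: The $k$-hyperopic game of cops and robber ($k \ge 1$ an integer) on a finite connected simple graph $G$ is played by a team of cops (controlled by one player) and one robber, all occupying vertices of $G$. First the cops choose their starting vertices (several cops may share a vertex), then the robber chooses his starting vertex. Then the players alternate turns, cops first: on the cops' turn each cop stays or moves to an adjacent vertex; on the robber's turn he stays or moves to an adjacent vertex. The robber always sees the positions of all cops. The robber is invisible to the cops whenever every cop satisfies $1 \le d(r,c) \le k$, where $r$ and $c$ are the current positions of the robber and that cop and $d$ is graph distance; otherwise (in particular whenever some cop is at distance greater than $k$ from him) his position is known to all cops. The robber is omniscient: he knows the complete strategy of the cops in advance, so he is never captured by chance, i.e. a winning cop strategy must guarantee capture against every possible play of the robber. The cops win if after finitely many rounds some cop occupies the same vertex as the robber; otherwise the robber wins. The $k$-hyperopic cop number $c_{H,k}(G)$ is the minimum number of cops that have a winning strategy on $G$. The diameter $\operatorname{diam}(G)$ is the maximum distance between two vertices of $G$. *)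

(* Defs.v *)
From mathcomp Require Import all_boot boolp.

Set Implicit Arguments.
Unset Strict Implicit.
Unset Printing Implicit Defensive.

Section Graph.

Variables (V : finType) (e : rel V).

Definition simple_graph : Prop := symmetric e /\ irreflexive e.

Definition connected_graph : Prop := (0 < #|V|) /\ forall x y : V, connect e x y.

(* Cycles in simple graphs have length at least 3; [ucycle e] also accepts the
   shorter closed walks [::] and x, y, x. *)
Definition acyclic : Prop := forall c : seq V, ucycle e c -> size c < 3.

Definition is_tree : Prop := [/\ simple_graph, connected_graph & acyclic].

Definition walk_of_length (n : nat) (x y : V) : bool :=
  [exists p : n.-tuple V, path e x p && (last x p == y)].

(* Least length of a walk from x to y; the junk value #|V| is taken exactly when
   x and y are not connected, since a shortest walk has length < #|V|. *)
Definition dist (x y : V) : nat :=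
  find (fun n => walk_of_length n x y) (iota 0 #|V|).

Definition diam : nat := \max_(x : V) \max_(y : V) dist x y.

End Graph.

Section HyperopicGame.

Variables (V : finType) (e : rel V) (k : nat).

Definition stay_or_move (x y : V) : bool := (x == y) || e x y.

Definition cop_config (m : nat) := {ffun 'I_m -> V}.

Definition invisible (m : nat) (c : cop_config m) (r : V) : bool :=
  [forall i, 1 <= dist e r (c i) <= k].

Definition captured (m : nat) (c : cop_config m) (r : V) : bool :=
  [exists i, c i == r].

(* What the cops learn about the robber in a given position of the game. *)
Definition observe (m : nat) (c : cop_config m) (r : V) : option V :=
  if invisible c r then None else Some r.

(* The cops move according to their current positions and to all observations
   made so far (oldest first). Their own past positions are determined by this
   data, so they need not be recorded. *)
Record cop_strategy (m : nat) := CopStrategy {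
  cop_start : cop_config m;
  cop_move : cop_config m -> seq (option V) -> cop_config m;
  cop_moveP : forall (c : cop_config m) (h : seq (option V)) (i : 'I_m),
    stay_or_move (c i) (cop_move c h i)
}.

(* r 0 is the robber's starting vertex and r t.+1 his position after his
   (t.+1)-st turn. *)
Definition robber_play (r : nat -> V) : Prop :=
  forall t, stay_or_move (r t) (r t.+1).

(* Cop positions and observation history after t full rounds. An observation is
   made after the initial placement, and then after each turn of either side. *)
Fixpoint run (m : nat) (s : cop_strategy m) (r : nat -> V) (t : nat) :
    cop_config m * seq (option V) :=
  if t is t'.+1 then
    let: (c, h) := run s r t' in
    let c' := cop_move s c h in
    (c', h ++ [:: observe c' (r t'); observe c' (r t'.+1)])
  else (cop_start s, [:: observe (cop_start s) (r 0)]).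

Definition cops_at (m : nat) (s : cop_strategy m) (r : nat -> V) (t : nat) :
  cop_config m := (run s r t).1.

(* The robber's omniscience is the quantification over all of his plays, each
   of which may depend on s. Capture can occur after a turn of the robber (or
   the initial placement) or after a turn of the cops. *)
Definition winning (m : nat) (s : cop_strategy m) : Prop :=
  forall r, robber_play r ->
  exists t, captured (cops_at s r t) (r t) \/ captured (cops_at s r t.+1) (r t).

Definition cops_win (m : nat) : Prop := exists s : cop_strategy m, winning s.

Lemma ex_cops_win : exists m, `[< cops_win m >].
Proof.
exists #|V|; apply/asboolP.
have stayP (c : cop_config #|V|) (h : seq (option V)) i :
  stay_or_move (c i) (c i) by rewrite /stay_or_move eqxx.
exists (CopStrategy [ffun i => enum_val i] stayP) => r _; exists 0; left.
by apply/existsP; exists (enum_rank (r 0)); rewrite ffunE enum_rankK.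
Qed.

Definition hyperopic_cop_number : nat := ex_minn ex_cops_win.

End HyperopicGame.

(* Main.v *)
Require Import Defs.
From mathcomp Require Import all_boot boolp.
From mathcomp Require Import zify.

(** For [k = 1] the tree is a single vertex; let [k > 1].  Two vertices at
    distance [diam e] are connected by a path that contains an edge [c1 c2]
    with at least [k - 2] edges on either side of it.  Two cops
    stay forever at the ends [u] (on the side of [c1]) and [w] (on the side of
    [c2]).  A robber who is on the side of [c1] at distance at least 2 from
    [c1] is separated from [w] by the whole edge, so he is at distance at least
    [2 + 1 + (k - 2) > k] from [w] and is visible; the situation on the other
    side is symmetric ([far_from_guards]).  The robber can thus hide only in
    the double star formed by the hubs [c1], [c2] and their neighbours.

    The third cop, the chaser, acts on the sightings of such far vertices only.
    - Before any sighting, he visits the neighbours of [c1] one by one and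
      returns to [c1] in between; then he does the same at [c2].  As long as
      the robber hides in the double star, he cannot step on the hub that is
      being patrolled, so he is frozen on a neighbour of it and is found there
      ([hub_walk_sweeps]), unless he is on the side of [c2] during the first
      sweep; he cannot come back through [c1].  Hence he is caught or becomes
      far at some time ([ex_far]).
    - After a sighting, the chaser always steps towards the last far position
      of the robber.  Let [c] be the hub on the robber's side and [g] the
      neighbour of [c] through which he went.  At the first sighting the chaser
      is within 2 of [c] while the robber is at distance at least 2 from [c],
      so the chaser is there in time to keep the robber beyond the edge [c g],
      and the last far position stays on that side too ([gate_pursuit]).  Once
      the chaser is on [g], everything left to the robber is far, he is always
      visible, and his territory shrinks at every round ([deep_pursuit]).

    The facts about trees that this uses are that the distances to a given
    vertex from two adjacent vertices differ by exactly one ([dist_edge]), that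
    the neighbour closer to a given vertex is unique ([closer_inj]), and that
    an edge separates its two sides ([cut_dist], [beyond_crossing]). *)

Set Implicit Arguments.
Unset Strict Implicit.
Unset Printing Implicit Defensive.

(** * Distances in a tree *)

Section Tree.

Variables (V : finType) (e : rel V).
Hypothesis e_tree : is_tree e.

Local Notation d := (dist e).

Let e_sym : symmetric e. Proof. by case: e_tree => -[]. Qed.
Let e_irr : irreflexive e. Proof. by case: e_tree => -[]. Qed.
Let e_conn x y : connect e x y. Proof. by case: e_tree => _ [_ ->]. Qed.

Lemma walkP n x y :
  reflect (exists p, [/\ path e x p, last x p = y & size p = n])
          (walk_of_length e n x y).
Proof.
apply: (iffP existsP) => [[p /andP[ep /eqP lp]]|[p [ep lp /eqP sp]]].
  by exists p; rewrite size_tuple.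
by exists (Tuple sp); rewrite /= ep lp eqxx.
Qed.

Lemma dist_le_walk n x y : walk_of_length e n x y -> d x y <= n.
Proof.
move=> xy; rewrite leqNgt; apply/negP => lt_n.
have n_lt : n < #|V|.
  by apply: leq_trans lt_n _; rewrite -[X in _ <= X](size_iota 0) find_size.
by have := before_find 0 lt_n; rewrite nth_iota // add0n xy.
Qed.

Lemma dist_walk x y : walk_of_length e (d x y) x y.
Proof.
have has_walk : has (fun n => walk_of_length e n x y) (iota 0 #|V|).
  have /connectP[p0 ep0 ->] := e_conn x y.
  case: (shortenP ep0) => p ep up _.
  apply/hasP; exists (size p); last by apply/walkP; exists p.
  rewrite mem_iota /= add0n -[_.+1]/(size (x :: p)) -(card_uniqP up).
  exact: max_card.
have := nth_find 0 has_walk; rewrite nth_iota //.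
by have := has_walk; rewrite has_find size_iota.
Qed.

Lemma distxx x : d x x = 0.
Proof. by apply/eqP; rewrite -leqn0; apply/dist_le_walk/walkP; exists [::]. Qed.

Lemma dist_eq0 x y : d x y = 0 -> x = y.
Proof.
by move=> d0; have := dist_walk x y; rewrite d0 => /walkP[[|a p] []].
Qed.

Lemma distC x y : d x y = d y x.
Proof.
suff le z t : d z t <= d t z by apply/eqP; rewrite eqn_leq !le.
have /walkP[p [ep lp sp]] := dist_walk t z.
apply/dist_le_walk/walkP; exists (rev (belast t p)); split.
- by rewrite -lp rev_path; apply: sub_path ep => a b; rewrite e_sym.
- by case: (p) lp => [|a s] //= _; rewrite rev_cons last_rcons.
- by rewrite size_rev size_belast.
Qed.

Lemma dist_edge_le x y z : e x y -> d x z <= (d y z).+1.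
Proof.
move=> xy; have /walkP[p [ep lp sp]] := dist_walk y z.
by apply/dist_le_walk/walkP; exists (y :: p); rewrite /= xy ep lp sp.
Qed.

Lemma ex_closer x z : x != z -> exists2 y, e x y & d x z = (d y z).+1.
Proof.
move=> xz; have /walkP[[|y p] [/= ep lp sp]] := dist_walk x z.
  by rewrite lp eqxx in xz.
case/andP: ep => xy ep; exists y => //.
have := dist_edge_le z xy; suff: d y z <= size p by lia.
by apply/dist_le_walk/walkP; exists p.
Qed.

Lemma dist_triangle x y z : d x z <= d x y + d y z.
Proof.
have [n] := ubnP (d x y); elim: n x => // n IH x lt_n.
have [->|/ex_closer[x' xx' dx]] := eqVneq x y; first by rewrite distxx.
by have := dist_edge_le z xx'; have := IH x'; lia.
Qed.

Definition without_edge (x y : V) : rel V :=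
  [rel a b | e a b && ~~ ((a == x) && (b == y) || (a == y) && (b == x))].

(** Every edge of a forest is a bridge: a simple path that joins its ends
    without using it would close up to a cycle. *)
Lemma edge_bridge x y : e x y -> ~~ connect (without_edge x y) x y.
Proof.
move=> xy; apply/connectP => -[p0 ep0 ly].
move: ly; case: (shortenP ep0) => p ep up _ ly.
have [_ _ acy] := e_tree.
have ep1 : path e x p by apply: sub_path ep => a b /andP[].
have : size (x :: p) < 3.
  by apply: acy; rewrite /ucycle up andbT /= rcons_path ep1 -ly e_sym.
case: p ep ly {up ep1} => [|a [|//]] /= ep ly.
  by rewrite ly e_irr in xy.
by move: ep; rewrite /without_edge /= -ly !eqxx andbF.
Qed.

(** Descending towards [z] from a vertex at distance at most [m] never leaves
    the ball of radius [m], so it avoids every edge between two vertices at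
    the same distance from [z], or with an end outside the ball. *)
Lemma connect_down m x z :
  d x z <= m -> connect [rel a b | [&& e a b, d b z < d a z & d a z <= m]] x z.
Proof.
have [n] := ubnP (d x z); elim: n x => // n IH x lt_n le_m.
have [->|/ex_closer[y xy dx]] := eqVneq x z; first exact: connect0.
by apply: (connect_trans (connect1 _)) (IH y _ _) => /=; rewrite ?xy; lia.
Qed.

Lemma without_edge_sym x y : connect_sym (without_edge x y).
Proof.
apply: sym_connect_sym => a b; rewrite /without_edge /=.
by rewrite e_sym orbC [(a == y) && _]andbC [(a == x) && _]andbC.
Qed.

(** Descents to [z] from two adjacent vertices at the same distance would form
    a detour around their edge. *)
Lemma dist_edge_neq x y z : e x y -> d x z != d y z.
Proof.
move=> xy; apply/eqP => dxy; move/negP: (edge_bridge xy); apply.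
have cz t : connect (without_edge x y) t z.
  apply: connect_sub (connect_down (leqnn (d t z))) => a b /= /and3P[ab lt_ba _].
  apply: connect1; rewrite /without_edge /= ab /=; apply/negP.
  by case/orP=> /andP[/eqP ea /eqP eb]; move: lt_ba; rewrite ea eb dxy ltnn.
by apply: connect_trans (cz x) _; rewrite without_edge_sym.
Qed.

(** If [x] and [y] were distinct, descending from both to [z] would give a
    detour around the edge [p x] through [y]. *)
Lemma closer_inj p x y z :
  e p x -> e p y -> d x z < d p z -> d y z < d p z -> x = y.
Proof.
move=> px py xz yz; apply/eqP/negPn/negP => neq_xy.
move/negP: (edge_bridge px); apply.
have cz t : d t z < d p z -> connect (without_edge p x) t z.
  move=> lt_tp; have le_t : d t z <= (d p z).-1 by lia.
  apply: connect_sub (connect_down le_t) => a b /= /and3P[ab lt_ba le_a].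
  apply: connect1; rewrite /without_edge /= ab /=; apply/negP.
  by case/orP=> /andP[/eqP ea /eqP eb]; move: lt_ba le_a; rewrite ea eb; lia.
have cpy : connect (without_edge p x) p y.
  apply: connect1; rewrite /without_edge /= py eqxx /= (eq_sym y) (negbTE neq_xy) /=.
  by apply/negP => /andP[_ /eqP yp]; rewrite yp e_irr in py.
apply: connect_trans cpy (connect_trans (cz y yz) _).
by rewrite without_edge_sym cz.
Qed.

Lemma dist_edge x y z : e x y -> d x z = (d y z).+1 \/ d y z = (d x z).+1.
Proof.
move=> xy; have yx : e y x by rewrite e_sym.
have := dist_edge_neq z xy; have := dist_edge_le z xy.
by have := dist_edge_le z yx; lia.
Qed.

(** For an edge [a b], the component of [b] after the deletion of the edge. *)
Definition beyond (a b v : V) : bool := d b v < d a v.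

Lemma beyondN a b v : e a b -> ~~ beyond a b v = beyond b a v.
Proof. by move=> /(dist_edge v); rewrite /beyond; lia. Qed.

(** All walks between the two sides of an edge use it.  The induction moves
    [v] towards [a].  The distance to [w] drops at this step, since otherwise
    [v] would be the unique neighbour of its successor [v1] closer to [w]; but
    that is the next vertex on the way to [a], or [b] if [v1] is [a]. *)
Lemma cut_dist a b v w :
  e a b -> beyond b a v -> beyond a b w -> d v w = d v a + (d b w).+1.
Proof.
rewrite /beyond => ab + bw.
have da : d a w = (d b w).+1 by have := dist_edge w ab; lia.
have [n] := ubnP (d v a); elim: n v => // n IH v lt_n av.
have [->|/ex_closer[v1 vv1 dv]] := eqVneq v a; first by rewrite distxx da.
have v1v : e v1 v by rewrite e_sym.
have dav : d a v = (d a v1).+1 by rewrite distC dv distC.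
have av1 : d a v1 < d b v1.
  by have := dist_edge_le b vv1; rewrite ![d _ b]distC; lia.
have dv1 : d v1 w = d v1 a + (d b w).+1 by apply: IH => //; lia.
case: (dist_edge w vv1) => [->|dvw]; first by rewrite dv1 dv.
have [v1a|/ex_closer[v2 v12 dv2]] := eqVneq v1 a.
  subst v1.
  have vb : v = b by apply: (closer_inj (z := w) v1v ab); lia.
  by move: av; rewrite vb distxx ltn0.
have dav2 : d a v1 = (d a v2).+1 by rewrite distC dv2 distC.
have av2 : d a v2 < d b v2.
  by have := dist_edge_le b v12; rewrite ![d _ b]distC; lia.
have dv2w : d v2 w = d v2 a + (d b w).+1 by apply: IH => //; lia.
have vv2 : v = v2 by apply: (closer_inj (z := w) v1v v12); lia.
by move: dav dav2; rewrite vv2; lia.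
Qed.

Lemma beyond_crossing a b v v' :
  e a b -> stay_or_move e v v' -> beyond a b v -> ~~ beyond a b v' ->
  v = b /\ v' = a.
Proof.
move=> ab /orP[/eqP <-|vv'] bv; first by rewrite bv.
rewrite beyondN // => av'; have := cut_dist ab av' bv.
have : d v' v <= 1.
  by rewrite -(distxx v); apply: dist_edge_le; rewrite e_sym.
by split; [apply/esym|]; apply: dist_eq0; lia.
Qed.

Definition next (p q : V) : V :=
  if [pick x | e p x && (d x q < d p q)] is Some x then x else p.

Lemma nextP p q : p != q -> e p (next p q) /\ beyond p (next p q) q.
Proof.
rewrite /next => /ex_closer[y py dp]; case: pickP => [x /andP[]//|].
by move=> /(_ y); rewrite py dp ltnSn.
Qed.

Lemma next_eq p x q : e p x -> beyond p x q -> next p q = x.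
Proof.
move=> px bx; have pq : p != q by apply: contraTneq bx => <-; rewrite /beyond distxx.
by have [pn bn] := nextP pq; apply: closer_inj pn px bn bx.
Qed.

Lemma stay_or_move_next p q : stay_or_move e p (next p q).
Proof.
rewrite /stay_or_move /next; case: pickP => [x /andP[->]|_]; rewrite ?orbT ?eqxx //.
Qed.

(** * The chaser's search and pursuit *)

(** Two neighbours of [c] are equally far from [c], hence not adjacent: a
    robber next to [c] who neither steps on [c] nor becomes far must stay. *)
Lemma near_confined c c' v v' :
  e c c' -> beyond c' c v -> v != c -> v' != c -> stay_or_move e v v' ->
  (d c v <= 1) || (d c' v <= 1) -> (d c v' <= 1) || (d c' v' <= 1) -> v' = v.
Proof.
move=> cc' bv vc v'c mv near_v near_v'.
have c'c : e c' c by rewrite e_sym.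
have bv' : beyond c' c v'.
  by apply: contraNT vc => nb; have [-> _] := beyond_crossing c'c mv bv nb.
have far1 z : z != c -> 0 < d c z.
  by rewrite lt0n; apply: contraNneq => /dist_eq0 ->.
have := far1 v vc; have := far1 v' v'c; move: bv bv'; rewrite /beyond => *.
case/orP: mv => [/eqP //|/(dist_edge_neq c)]; rewrite ![d _ c]distC.
by move=> /eqP; lia.
Qed.

Section Chase.

Variables c1 c2 : V.

Definition far (v : V) : bool := (1 < d c1 v) && (1 < d c2 v).

(** The walk [c], [x0], [c], [x1], ... through the neighbours of [c].  It runs
    through all vertices and waits at [c] in place of one that is not adjacent
    to [c], so that its length is the same for both hubs. *)
Definition hub_walk (c : V) (s : nat) : V :=
  let x := nth c (enum V) s./2 in if odd s && e c x then x else c.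

(** The last visit of the first walk to [c1], at time [2 #|V|], is followed
    directly by the first visit of the second walk to [c2]. *)
Definition patrol (t : nat) : V :=
  if t <= #|V|.*2 then hub_walk c1 t else hub_walk c2 (t - #|V|.*2.+1).

Definition update (q : option V) (v : V) : option V :=
  if far v then Some v else q.

(** The test [stay_or_move] makes this a legal move from any vertex [p]; it
    succeeds whenever the chaser is on his patrol. *)
Definition chaser_move (t : nat) (p : V) (q : option V) : V :=
  if q is Some v then next p v
  else if stay_or_move e p (patrol t.+1) then patrol t.+1 else p.

Lemma stay_or_move_chaser t p q : stay_or_move e p (chaser_move t p q).
Proof.
rewrite /chaser_move; case: q => [v|]; first exact: stay_or_move_next.
by case: ifP => // _; rewrite /stay_or_move eqxx.
Qed.

Lemma hub_walk_even c s : ~~ odd s -> hub_walk c s = c.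
Proof. by rewrite /hub_walk => /negbTE ->. Qed.

Lemma hub_walk_step c s : stay_or_move e (hub_walk c s) (hub_walk c s.+1).
Proof.
have [s_odd|s_even] := boolP (odd s).
  rewrite [hub_walk c s.+1]hub_walk_even /= ?s_odd // /hub_walk s_odd /=.
  by case: ifP => [cx|_]; rewrite /stay_or_move ?eqxx // e_sym cx orbT.
rewrite hub_walk_even // /hub_walk /= s_even /=.
by case: ifP => [cx|_]; rewrite /stay_or_move ?eqxx // cx orbT.
Qed.

Lemma dist_hub_walk c s : d c (hub_walk c s) <= 1.
Proof.
rewrite /hub_walk; case: ifP => [/andP[_ cx]|_]; last by rewrite distxx.
by rewrite (leq_trans (dist_edge_le _ cx)) ?distxx.
Qed.

Lemma patrol_near t : (d c1 (patrol t) <= 1) || (d c2 (patrol t) <= 1).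
Proof. by rewrite /patrol; case: ifP => _; rewrite dist_hub_walk ?orbT. Qed.

Hypothesis c12 : e c1 c2.

Lemma patrol_step t : stay_or_move e (patrol t) (patrol t.+1).
Proof.
rewrite /patrol; case: (ltngtP t #|V|.*2) => [lt_t|gt_t|->].
- exact: hub_walk_step.
- by rewrite (_ : t.+1 - _ = (t - #|V|.*2.+1).+1) ?hub_walk_step; lia.
- by rewrite subnn !hub_walk_even ?odd_double // /stay_or_move c12 orbT.
Qed.

Section Play.

Variable r : nat -> V.

Fixpoint seen (t : nat) : option V :=
  if t is s.+1 then update (seen s) (r t) else update None (r 0).

Fixpoint chaser (t : nat) : V :=
  if t is s.+1 then chaser_move s (chaser s) (seen s) else c1.

Lemma seen_far t : far (r t) -> seen t = Some (r t).
Proof. by case: t => [|t] /= ft; rewrite /update ft. Qed.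

Lemma chaser_patrol t : (forall s, s < t -> ~~ far (r s)) -> chaser t = patrol t.
Proof.
elim: t => [|t IH] near; first by rewrite /= /patrol hub_walk_even.
have none s : s <= t -> seen s = None.
  elim: s => [|s IHs] le_s /=; rewrite /update (negbTE (near _ _)) //.
  by rewrite IHs // ltnW.
rewrite /= IH => [|s lt_s]; last by apply: near; rewrite ltnW.
by rewrite none // /chaser_move patrol_step.
Qed.

Hypothesis r_play : robber_play e r.
Hypothesis uncaught : forall t, chaser t != r t.
Hypothesis uncaught_move : forall t, chaser t.+1 != r t.

(** A robber who stays within distance one of the hubs can only leave a
    neighbour of [c] through [c], where the chaser is after every second move:
    he is frozen until the chaser visits his vertex. *)
Lemma hub_walk_sweeps c c' t0 :
  e c c' -> (forall v, ~~ far v = (d c v <= 1) || (d c' v <= 1)) ->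
  (forall s, s <= #|V|.*2 -> chaser (t0 + s) = hub_walk c s) ->
  (forall t, ~~ far (r t)) -> ~~ beyond c' c (r t0).
Proof.
move=> cc' farE walk near; apply/negP => b0.
have off s : s <= #|V|.*2 -> r (t0 + s) != c.
  move=> le_s; have [s_odd|s_even] := boolP (odd s); last first.
    by rewrite eq_sym -(hub_walk_even c s_even) -walk.
  have le_s1 : s.+1 <= #|V|.*2 by have := odd_double #|V|; lia.
  rewrite eq_sym -(@hub_walk_even c s.+1) /= ?s_odd // -walk // addnS.
  exact: uncaught_move.
have fixed s : s <= #|V|.*2 -> r (t0 + s) = r t0.
  elim: s => [|s IH] le_s; first by rewrite addn0.
  have rs := IH (ltnW le_s); rewrite addnS -rs.
  apply: (near_confined cc') (r_play _) _ _; rewrite -?farE ?near ?rs //.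
    by rewrite -rs off // ltnW.
  by rewrite -addnS off.
have c_r0 : e c (r t0).
  have := near t0; rewrite farE; move: b0; rewrite /beyond => b0 near0.
  have rc : r t0 != c by rewrite -[t0]addn0 off.
  have [y cy dcy] : exists2 y, e c y & d c (r t0) = (d y (r t0)).+1.
    by apply: ex_closer; rewrite eq_sym.
  by rewrite -(@dist_eq0 y (r t0)) //; lia.
have i_lt : index (r t0) (enum V) < #|V| by rewrite cardE index_mem mem_enum.
set i := index _ _ in i_lt.
have le_i : i.*2.+1 <= #|V|.*2 by rewrite ltn_double.
have := uncaught (t0 + i.*2.+1); rewrite walk // fixed //.
rewrite /hub_walk /= odd_double /= uphalf_double nth_index ?mem_enum //.
by rewrite c_r0 eqxx.
Qed.

(** The first sweep leaves only the side of [c2]; to return, the robber would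
    have to step on [c1], where the chaser is or arrives with his next move.
    The same argument at [c2] puts him next to [c2] for the second sweep. *)
Lemma ex_far : exists t, far (r t).
Proof.
apply: contrapT => no_far; have near t : ~~ far (r t).
  by apply/negP => ft; apply: no_far; exists t.
have c21 : e c2 c1 by rewrite e_sym.
have farE v : ~~ far v = (d c1 v <= 1) || (d c2 v <= 1).
  by rewrite /far negb_and -!leqNgt.
have walk t : chaser t = patrol t by apply: chaser_patrol.
have start : ~~ beyond c2 c1 (r 0).
  apply: (hub_walk_sweeps c12) => // s le_s.
  by rewrite walk /patrol add0n le_s.
have stay s : s <= #|V|.*2 -> beyond c1 c2 (r s).
  elim: s => [|s IH] le_s; first by rewrite -beyondN.
  apply: contraT => nb.
  have [_ rc] := beyond_crossing c12 (r_play s) (IH (ltnW le_s)) nb.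
  have [s_odd|s_even] := boolP (odd s.+1).
    have := uncaught_move s.+1; rewrite walk rc /patrol.
    have -> : s.+2 <= #|V|.*2 by have := odd_double #|V|; lia.
    by rewrite hub_walk_even ?eqxx //= -/(odd s.+1) s_odd.
  by have := uncaught s.+1; rewrite walk rc /patrol le_s hub_walk_even ?eqxx.
have at_c2 : chaser #|V|.*2.+1 = c2.
  by rewrite walk /patrol ltnn subnn hub_walk_even.
have : ~~ beyond c1 c2 (r #|V|.*2.+1).
  apply: (hub_walk_sweeps c21) => // [v|s le_s]; first by rewrite farE orbC.
  rewrite walk /patrol addSn ltnNge leq_addr /= -addSn.
  by rewrite [_ + s]addnC addnK.
move=> nb; have [rc _] := beyond_crossing c12 (r_play _) (stay _ (leqnn _)) nb.
by have := uncaught_move #|V|.*2; rewrite at_c2 rc eqxx.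
Qed.

(** Once the robber is confined to a branch of far vertices he is always seen,
    and every move of the chaser shrinks the branch. *)
Lemma deep_pursuit t x :
  e (chaser t) x -> (forall v, beyond (chaser t) x v -> far v) ->
  ~~ beyond (chaser t) x (r t).
Proof.
have [n] := ubnP #|[set v | beyond (chaser t) x v]|.
elim: n t x => // n IH t x card_n px deep; apply/negP => br.
have pt : chaser t.+1 = x.
  by rewrite /= seen_far ?deep // /chaser_move (next_eq px).
have br' : beyond (chaser t) x (r t.+1).
  apply: contraT => nb; have [rx _] := beyond_crossing px (r_play t) br nb.
  by have := uncaught_move t; rewrite pt rx eqxx.
have xr : x != r t.+1 by rewrite -pt.
have [xy by_r] := nextP xr; set y := next _ _ in xy by_r.
have sub v : beyond x y v -> beyond (chaser t) x v.
  move=> by_v; apply: contraT; rewrite beyondN // => bp.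
  have xp : e x (chaser t) by rewrite e_sym.
  have yp : y = chaser t := closer_inj xy xp by_v bp.
  by move: br' by_r; rewrite yp /beyond; lia.
suff: ~~ beyond (chaser t.+1) y (r t.+1) by rewrite pt by_r.
apply: IH; rewrite pt //; last by move=> v /sub /deep.
apply: leq_trans (_ : #|[set v | beyond (chaser t) x v]| <= _) => //.
apply/proper_card/properP; split.
  by apply/subsetP => v; rewrite !inE => /sub.
exists x; rewrite !inE /beyond distxx ?ltn0 // lt0n.
by apply: contraTneq px => /dist_eq0 ->; rewrite e_irr.
Qed.

(** The vertex [g] is the only place beyond the edge [b g] where the robber can
    hide, so with the chaser on [g] he is in the situation of a deep pursuit. *)
Lemma branch_entered t b g :
  e b g -> (forall z, beyond b g z -> z != g -> far z) ->
  chaser t = g -> beyond b g (r t) -> False.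
Proof.
move=> bg deep pt br; have gb : e g b by rewrite e_sym.
have gr : g != r t by rewrite -pt.
have [gy by_r] := nextP gr.
suff: ~~ beyond (chaser t) (next g (r t)) (r t) by rewrite pt by_r.
apply: deep_pursuit; rewrite pt // => z bz.
have zg : z != g by apply: contraTneq bz => ->; rewrite /beyond distxx.
apply: deep => //; apply: contraT; rewrite beyondN // => bbz.
have yb : next g (r t) = b := closer_inj gy gb bz bbz.
by move: br by_r; rewrite yb /beyond; lia.
Qed.

(** The chaser reaches [b] before the robber, who is beyond the edge [b g],
    can get out through it: the chaser's distance from [b] does not exceed the
    robber's, and this remains so, as the chaser approaches [b] by one at each
    turn.  His target need not be the current position of the robber, but it
    lies in the same branch, so he goes the right way. *)
Lemma gate_pursuit t b g v :
  e b g -> (forall z, beyond b g z -> z != g -> far z) ->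
  ~~ beyond b g (chaser t) -> seen t = Some v -> beyond b g v ->
  beyond b g (r t) -> d b (chaser t) <= d b (r t) -> False.
Proof.
move=> bg deep; have [n] := ubnP (d b (chaser t)).
elim: n t v => // n IH t v lt_n out_p st bv br le_b.
have gb : e g b by rewrite e_sym.
have pt : chaser t.+1 = next (chaser t) v by rewrite /= st.
have bp : beyond g b (chaser t) by rewrite -beyondN.
have [pb|pb] := eqVneq (chaser t) b.
  have {}pt : chaser t.+1 = g by rewrite pt pb (next_eq bg).
  have br' : beyond b g (r t.+1).
    apply: contraT => nb; have [rg _] := beyond_crossing bg (r_play t) br nb.
    by have := uncaught_move t; rewrite pt rg eqxx.
  exact: branch_entered bg deep pt br'.
have [py by_b] := nextP pb; set y := next _ b in py by_b.
have yb : beyond g b y.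
  apply: contraT; rewrite beyondN // => bgy.
  have := cut_dist bg bp bgy; have : d y (chaser t) <= 1.
    by rewrite -(distxx (chaser t)) dist_edge_le // e_sym.
  rewrite distC; have : 0 < d (chaser t) b.
    by rewrite lt0n; apply: contraNneq pb => /dist_eq0 ->.
  by lia.
(* [b] and then [g] lie on the path to [v] from both [y] and the chaser *)
have y_eq : next (chaser t) v = y.
  apply: next_eq => //.
  by rewrite /beyond (cut_dist bg bp bv) (cut_dist bg yb bv) ltn_add2r.
rewrite y_eq in pt.
have dy : d b (chaser t) = (d b y).+1.
  have := dist_edge b py; move: by_b; rewrite /beyond ![d _ b]distC; lia.
have dr' : d b (r t) <= (d b (r t.+1)).+1.
  case/orP: (r_play t) => [/eqP ->//|rr']; rewrite ![d b _]distC.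
  exact: dist_edge_le.
have br' : beyond b g (r t.+1).
  apply: contraT => nb; have [_ rb] := beyond_crossing bg (r_play t) br nb.
  have yb0 : d b y = 0 by move: dr' le_b; rewrite rb distxx; lia.
  by have := uncaught t.+1; rewrite pt rb (dist_eq0 yb0) eqxx.
have [v' sv' bv'] : exists2 v', seen t.+1 = Some v' & beyond b g v'.
  by rewrite /= /update; case: ifP => _; [exists (r t.+1)|exists v].
apply: (IH t.+1 v') => //; rewrite ?pt ?beyondN //; lia.
Qed.

(** The gate is the neighbour [g] of the robber's hub [c] towards him.  A
    chaser who is not far is either within two of [c] and outside the branch of
    [g], or on [g] itself. *)
Lemma far_pursuit c c' t :
  e c c' -> (forall v, far v = (1 < d c v) && (1 < d c' v)) ->
  ~~ far (chaser t) -> far (r t) -> beyond c' c (r t) -> False.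
Proof.
move=> cc' farE near_p far_r br; have c'c : e c' c by rewrite e_sym.
have cr : c != r t.
  by apply: contraTneq far_r => <-; rewrite farE distxx.
have [cg bg] := nextP cr; set g := next c (r t) in cg bg.
have deep z : beyond c g z -> z != g -> far z.
  move=> bz zg; have bz' : beyond c' c z.
    apply: contraT; rewrite beyondN // => bz'.
    have gc' : g = c' := closer_inj cg cc' bz bz'.
    by move: br bg; rewrite gc' /beyond; lia.
  have : 0 < d g z by rewrite lt0n; apply: contraNneq zg => /dist_eq0 ->.
  by move: bz bz'; rewrite farE /beyond; lia.
have [bp|out_p] := boolP (beyond c g (chaser t)).
  apply: (branch_entered cg deep) (bg); apply/eqP.
  by apply: contraNT near_p => /(deep _ bp).
apply: (gate_pursuit cg deep out_p (seen_far far_r) bg bg).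
move: near_p far_r; rewrite !farE => near_p /andP[far_r _].
have := dist_edge_le (chaser t) cc'; lia.
Qed.

End Play.

Lemma chaser_wins r :
  robber_play e r -> exists t, chaser r t = r t \/ chaser r t.+1 = r t.
Proof.
move=> r_play; apply: contrapT => free.
have uncaught t : chaser r t != r t.
  by apply/eqP => pr; apply: free; exists t; left.
have uncaught_move t : chaser r t.+1 != r t.
  by apply/eqP => pr; apply: free; exists t; right.
have ex_f := ex_far r_play uncaught uncaught_move.
case: (ex_minnP ex_f) => t far_t min_t.
have near_p : ~~ far (chaser r t).
  rewrite chaser_patrol; last first.
    by move=> s lt_s; apply: contraL lt_s => /min_t; rewrite -leqNgt.
  by rewrite /far negb_and -!leqNgt patrol_near.
have [b2|] := boolP (beyond c1 c2 (r t)); last rewrite beyondN // => b1.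
  apply: (far_pursuit r_play uncaught uncaught_move _ _ near_p far_t b2).
    by rewrite e_sym.
  by move=> v; rewrite /far andbC.
exact: (far_pursuit r_play uncaught uncaught_move c12 _ near_p far_t b1).
Qed.

(** * The team of three cops *)

Section Guards.

Variables (k : nat) (u w : V).
Hypotheses (u_side : beyond c2 c1 u) (w_side : beyond c1 c2 w).
Hypotheses (u_deep : k <= (d c1 u).+2) (w_deep : k <= (d c2 w).+2).

(** A far vertex on the side of [c1] is separated from the guard [w] by both
    hubs, hence at distance at least [2 + 1 + (k - 2)] from him. *)
Lemma far_from_guards v : far v -> (k < d v u) || (k < d v w).
Proof.
case/andP=> v1 v2; have [b2|] := boolP (beyond c1 c2 v).
  have c21 : e c2 c1 by rewrite e_sym.
  by rewrite (cut_dist c21 b2 u_side) (distC v); lia.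
by rewrite beyondN // => b1; rewrite (cut_dist c12 b1 w_side) (distC v c1); lia.
Qed.

(** Cops 0 and 1 are the guards; cop 2 falls through to the default value [p]. *)
Definition team (p : V) : cop_config V 3 := [ffun i : 'I_3 => nth p [:: u; w] i].

(** An observation, even an empty one, says as much about far positions as the
    robber's position itself: an invisible robber is not far. *)
Lemma team_sees p q v :
  (if observe e k (team p) v is Some x then update q x else q) = update q v.
Proof.
rewrite /observe; case: ifP => // /forallP inv; rewrite /update ifN //.
apply/negP => /far_from_guards.
have := inv ord0; have := inv (Ordinal (isT : 1 < 3)); rewrite !ffunE /=.
by lia.
Qed.

Definition last_far (h : seq (option V)) : option V :=
  foldl (fun q o => if o is Some x then update q x else q) None h.

(** After [t] rounds there are [2 t + 1] observations, so half of their number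
    is the time. *)
Definition team_move (c : cop_config V 3) (h : seq (option V)) : cop_config V 3 :=
  [ffun i => if i == ord_max then chaser_move (size h)./2 (c i) (last_far h)
             else c i].

Lemma team_moveP (c : cop_config V 3) h i : stay_or_move e (c i) (team_move c h i).
Proof.
rewrite ffunE; case: ifP => _; first exact: stay_or_move_chaser.
by rewrite /stay_or_move eqxx.
Qed.

Definition team_strategy : cop_strategy e 3 := CopStrategy (team c1) team_moveP.

Lemma run_team r t :
  [/\ (run k team_strategy r t).1 = team (chaser r t),
      size (run k team_strategy r t).2 = t.*2.+1
    & last_far (run k team_strategy r t).2 = seen r t].
Proof.
elim: t => [|t]; first by split=> //=; rewrite /last_far /= team_sees.
rewrite /=; case: (run _ _ _ t) => c h [/= -> sh lh].
have move_eq : team_move (team (chaser r t)) h = team (chaser r t.+1).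
  apply/ffunP => i; rewrite !ffunE lh sh /= uphalf_double.
  by case: i => -[|[|[]]].
rewrite move_eq size_cat sh addn2; split=> //.
rewrite /last_far foldl_cat -/(last_far h) lh /= !team_sees.
(* between the two moves of a round the robber is where he was before *)
have -> // : update (seen r t) (r t) = seen r t.
by case: (t) => [|s]; rewrite /= /update; [case: (far (r 0))|case: (far (r s.+1))].
Qed.

Lemma team_wins : cops_win e k 3.
Proof.
exists team_strategy => r /chaser_wins[t catch_t]; exists t.
have capt s v : chaser r s = v -> captured (cops_at k team_strategy r s) v.
  move=> sv; apply/existsP; exists ord_max.
  by rewrite /cops_at; have [-> _ _] := run_team r s; rewrite ffunE /= sv.
by case: catch_t => /capt; [left|right].
Qed.

End Guards.

End Chase.

Lemma ex_geodesic x y m : m <= d x y -> exists2 z, d x z = m & d z y = d x y - m.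
Proof.
elim: m => [|m IH] le_m; first by exists x; rewrite ?distxx ?subn0.
have [z xz zy] := IH (ltnW le_m).
have [z1|/ex_closer[z1 zz1 dz]] := eqVneq z y.
  by move: zy; rewrite z1 distxx; lia.
exists z1; last by lia.
have := dist_triangle x z1 y; have := dist_triangle x z z1.
have : d z z1 <= 1 by rewrite -(distxx z1) dist_edge_le.
by lia.
Qed.

Lemma ex_diam : exists u w, d u w = diam e.
Proof.
have [_ [V_gt0 _] _] := e_tree.
have [u _ ->] : exists2 u, true & diam e = \max_(y : V) d u y.
  rewrite /diam.
  by have [u uE] := @eq_bigmax _ (fun x => \max_(y : V) d x y) V_gt0; exists u.
by have [w ->] := @eq_bigmax _ (d u) V_gt0; exists u, w.
Qed.

Lemma dist_le_diam x y : d x y <= diam e.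
Proof.
apply: leq_trans (leq_bigmax (F := fun x => \max_(y : V) d x y) x).
exact: (leq_bigmax (F := d x)).
Qed.

End Tree.

Theorem theorem4p8 (k : nat) (T : finType) (e : rel T)
    (k_gt0 : 0 < k) (e_tree : is_tree e)
    (diam_bounds : 2 * k - 3 <= diam e <= 2 * k - 2) :
  hyperopic_cop_number e k <= 3.
Proof.
suff win : cops_win e k 3.
  by rewrite /hyperopic_cop_number; case: ex_minnP => m _; apply; apply/asboolP.
have [u [w uw]] := ex_diam e_tree.
(* for [k = 1] the tree is a single vertex and has no edge to patrol *)
have [k1|k_gt1] := leqP k 1.
  have all_u v : u = v.
    by apply: (dist_eq0 e_tree); have := dist_le_diam e u v; lia.
  have stayP (c : cop_config T 3) (h : seq (option T)) i :
    stay_or_move e (c i) (c i) by rewrite /stay_or_move eqxx.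
  exists (CopStrategy [ffun=> u] stayP) => r _; exists 0; left.
  by apply/existsP; exists ord0; rewrite ffunE; apply/eqP.
(* [c1] is at distance [k - 2] from [u], and [c2] is the next vertex after it *)
have le_k2 : k - 2 <= dist e u w by lia.
have [c1 uc1 c1w] := ex_geodesic e_tree le_k2.
have c1_neq : c1 != w.
  by apply/eqP => cw; move: c1w; rewrite cw distxx; lia.
have [c2 c12 dc1] := ex_closer e_tree c1_neq.
have tri := dist_triangle e_tree u c2 w.
have le_c2 := dist_edge_le e_tree u c12.
have [uc1C uc2C] := (distC e_tree u c1, distC e_tree u c2).
by apply: (team_wins e_tree c12 (u := u) (w := w)); rewrite /beyond; lia.
Qed.
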